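(* Let $x_0>0$ and let $M(x)$ be a right-continuous, non-decreasing, unbounded function supported on $[x_0,\infty)$ with $M(x_0)=0$ and $M(x)\ll x^{\alpha_2}$ for some $\alpha_2>0$. Set $x_j=\inf\{x: M(x)\ge j\}$ for $j\ge1$ and assume $M(x_j)=j$ for every $j$. For each $j\ge1$ select $n_j$ randomly from $(x_{j-1},x_j]$ according to the probability measure $\mathrm{d}M(x)$ restricted to $(x_{j-1},x_j]$, independently for different $j$. Then with probability $1$ there is a constant $C$ (depending on the realized sequence) such that for all $x\ge x_0$ and all $t\in\mathbb{R}$, $$\Bigl|\sum_{n_j\le x}n_j^{-\mathrm{i} t}-\int_{x_0}^{x}u^{-\mathrm{i} t}\,\mathrm{d}M(u)\Bigr|\le C\sqrt{M(x)}\bigl(\sqrt{\log(x+1)}+\sqrt{\log(|t|+1)}\bigr)\log(x+1).$$ *)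

(* Defs.v *)
From HB Require Import structures.
From mathcomp Require Export all_boot all_order all_algebra.
From mathcomp Require Export finmap.
From mathcomp Require Export all_classical all_reals all_analysis.
From mathcomp Require Export complex.
Export Order.TTheory GRing.Theory Num.Theory.
Export numFieldNormedType.Exports.

Set Implicit Arguments.
Unset Strict Implicit.
Unset Printing Implicit Defensive.

Local Open Scope classical_set_scope.
Local Open Scope ring_scope.
Local Open Scope complex_scope.

Section complex_analysis.
Context {R : realType}.

Definition cexp (z : R[i]) : R[i] :=
  (expR (complex.Re z))%:C * (cos (complex.Im z) +i* sin (complex.Im z)).

(* Principal value of x ^ s; only meaningful for 0 < x, as ln x = 0 otherwise. *)
Definition cpow (x : R) (s : R[i]) : R[i] := cexp (s * (ln x)%:C).

Definition Cintegral d (T : measurableType d) (mu : {measure set T -> \bar R})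
    (D : set T) (f : T -> R[i]) : R[i] :=
  Rintegral mu D (fun u => complex.Re (f u)) +i* Rintegral mu D (fun u => complex.Im (f u)).

End complex_analysis.

(* Mutual independence of the subfamily (X i)_{i in I}. *)
Definition independent_RVs d d' (T : measurableType d) (T' : measurableType d')
    (R : realType) (P : probability T R) (J : choiceType) (I : set J)
    (X : J -> {RV P >-> T'}) : Prop :=
  forall (F : {fset J}) (B : J -> set T'),
    [set` F] `<=` I -> (forall i, measurable (B i)) ->
    P (\bigcap_(i in [set` F]) (X i @^-1` B i)) =
    (\prod_(i <- F) P (X i @^-1` B i))%E.

(* x_0 is the given starting point, x_j = inf {x : M(x) >= j} for j >= 1. *)
Definition level_point (R : realType) (x0 : R) (M : R -> R) (j : nat) : R :=
  if j is 0%N then x0 else inf [set x | j%:R <= M x].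

(* Main.v *)
(** Put [L = ln (k + 2) + ln (m + 2)].  For functions [f_(k,m)] bounded by 1, the
    centred sums [S_(k,m)] of [f_(k,m) (n_j)] over [1 <= j <= k] have exponential
    moments [E (exp (s S_(k,m))) <= exp (8 s^2 k)] for [0 <= s <= 1/4], by
    independence and [exp y <= 1 + y + 2 y^2].  The random variables
    [exp (s S_(k,m) - 8 s^2 k)] thus have mean at most 1, so their sum over [k, m]
    with weights [1 / ((k+1)(k+2)(m+1)(m+2))] is almost surely finite, and taking
    logarithms with [s = sqrt (L / k) / 4] gives [S_(k,m) = O (sqrt (k L))]
    simultaneously for all [k] and [m].  This is applied to
    [f_(k,m) u = phi ((m / k) ln u)] with [phi] one of [cos], [-cos], [sin], [-sin]:
    a general [t] is within [1 / k] of a grid point [m / k], and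
    [ln k = O (ln (x_k + 1))] by the growth of [M].  A general [x] lies between two
    consecutive level points, which costs at most one further term of the sum and
    mass at most [min (1, M x)] of the integral. *)

Require Import Defs.
From mathcomp Require Import measurable_realfun ring lra.

Set Implicit Arguments.
Unset Strict Implicit.
Unset Printing Implicit Defensive.

Local Open Scope classical_set_scope.
Local Open Scope ring_scope.
Local Open Scope complex_scope.

(** * Expectations of products of independent random variables *)

Section independence.
Context d d' (T : measurableType d) (T' : measurableType d') (R : realType)
  (P : probability T R).
Local Open Scope ereal_scope.
Import HBNNSimple.

(** The identity passes from indicators to simple functions by linearity, and then to [g] by
    monotone convergence. Finiteness of [c] makes multiplication by [c] commute with the limit. *)
Lemma ge0_integral_indep_comp (h : T -> R) (c : \bar R) (X : {RV P >-> T'})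
    (g : T' -> R) :
  measurable_fun setT h -> (forall w, 0 <= h w)%R -> c \is a fin_num ->
  measurable_fun setT g -> (forall u, 0 <= g u)%R ->
  (forall B, measurable B ->
    \int[P]_w (h w * \1_B (X w))%:E = c * \int[P]_w (\1_B (X w))%:E) ->
  \int[P]_w (h w * g (X w))%:E = c * \int[P]_w (g (X w))%:E.
Proof.
move=> mh h0 c0 mg g0 hB.
have mX : measurable_fun setT X by [].
have mg' : measurable_fun setT (EFin \o g) by exact/measurable_EFinP.
pose a := nnsfun_approx measurableT mg'.
have maX i : measurable_fun setT (fun w => a i (X w)).
  exact: (measurableT_comp _ mX).
have approx w : (a i (X w))%:E @[i --> \oo] --> (g (X w))%:E.
  by apply: (cvg_nnsfun_approx measurableT mg') => // u _; rewrite lee_fin.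
have a_nd w : {homo (fun i => a i (X w)) : i j / (i <= j)%N >-> (i <= j)%R}.
  move=> i j ij.
  by have /lefP := nd_nnsfun_approx measurableT mg' ij; exact.
have simple i : \int[P]_w (h w * a i (X w))%:E = c * \int[P]_w (a i (X w))%:E.
  have mpre r : measurable (a i @^-1` [set r]) by exact: measurable_sfunP.
  have mterm r : measurable_fun setT (fun w => (r * \1_(a i @^-1` [set r]) (X w))%R).
    apply: measurable_funM => //.
    by apply: (measurableT_comp _ mX); exact: measurable_indic.
  (* [r] itself may be negative, but the indicator vanishes unless [r] is a value of the nonnegative
     function [a i]. *)
  have term0 r w : (0 <= r * \1_(a i @^-1` [set r]) (X w))%R.
    rewrite indicE; case: (boolP (X w \in _)); last by rewrite mulr0.
    by rewrite inE/= mulr1 => <-.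
  transitivity (\sum_(r \in range (a i))
      \int[P]_w (h w * (r * \1_(a i @^-1` [set r]) (X w)))%:E).
    rewrite -ge0_integral_fsum//.
    - apply: eq_integral => w _; rewrite [X in (_ * X)%R]fimfunE.
      rewrite fsumEFin//; congr EFin.
      by rewrite !fsbig_finite//= big_distrr.
    - by move=> r; apply/measurable_EFinP; exact: measurable_funM.
    - by move=> r w _; rewrite lee_fin mulr_ge0.
  transitivity (c * \sum_(r \in range (a i))
      \int[P]_w (r * \1_(a i @^-1` [set r]) (X w))%:E); last first.
    congr (_ * _); rewrite -ge0_integral_fsum//.
    - by apply: eq_integral => w _; rewrite fsumEFin//; rewrite [in RHS]fimfunE.
    - by move=> r; apply/measurable_EFinP.
    - by move=> r w _; rewrite lee_fin.
  rewrite ge0_mule_fsumr; last by move=> r; apply: integral_ge0 => w _; rewrite lee_fin.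
  apply: eq_fsbigr => r; rewrite inE /= => -[u _ aur].
  have r0 : (0 <= r)%R by rewrite -aur.
  have mI : measurable_fun setT (fun w => \1_(a i @^-1` [set r]) (X w) : R).
    by apply: (measurableT_comp _ mX); exact: measurable_indic.
  under eq_integral do rewrite mulrCA EFinM.
  rewrite ge0_integralZl//; last 2 first.
    - by apply/measurable_EFinP; exact: measurable_funM.
    - by move=> w _; rewrite lee_fin mulr_ge0.
  under [in RHS]eq_integral do rewrite EFinM.
  rewrite [in RHS]ge0_integralZl//; last exact/measurable_EFinP.
  by rewrite hB// muleCA.
have lim_eq (f : T -> R) (f0 : forall w, (0 <= f w)%R) : measurable_fun setT f ->
    \int[P]_w (f w * a i (X w))%:E @[i --> \oo] --> \int[P]_w (f w * g (X w))%:E.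
  move=> mf.
  have -> : \int[P]_w (f w * g (X w))%:E =
      \int[P]_w (limn (fun i => (f w * a i (X w))%:E)).
    apply: eq_integral => w _; apply/esym/cvg_lim => //.
    under eq_fun do rewrite EFinM.
    by rewrite EFinM; apply: cvgeZl.
  apply: cvg_monotone_convergence => //.
  - by move=> i; apply/measurable_EFinP; exact: measurable_funM.
  - by move=> i w _; rewrite lee_fin mulr_ge0.
  - by move=> w _ i j ij; rewrite lee_fin ler_wpM2l// a_nd.
(* Monotone convergence is used with weight [h] and again with weight 1. The two sequences of
   integrals differ by the factor [c], hence so do their limits. *)
have := lim_eq h h0 mh.
under eq_fun do rewrite simple.
have := lim_eq (cst 1%R) (fun=> ler01) (measurable_cst _).
under eq_fun do under eq_integral do rewrite mul1r.
under eq_integral do rewrite mul1r.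
move=> l1 l2; apply: (cvg_unique _ l2) => //.
by apply: cvgeZl.
Qed.

Lemma prod_indic (J : Type) (s : seq J) (A : J -> set T) (w : T) :
  (\prod_(j <- s) \1_(A j) w = \1_(\big[setI/setT]_(j <- s) A j) w :> R)%R.
Proof.
elim: s => [|j s IH]; first by rewrite !big_nil indicT.
by rewrite !big_cons IH indicI.
Qed.

Lemma integral_prod_indep (J : choiceType) (I : set J) (X : J -> {RV P >-> T'})
    (F : {fset J}) (phi : J -> T' -> R) :
  independent_RVs I X -> [set` F] `<=` I ->
  (forall j, measurable_fun setT (phi j)) -> (forall j u, 0 <= phi j u)%R ->
  (forall j, \int[P]_w (phi j (X j w))%:E \is a fin_num) ->
  \int[P]_w (\prod_(j <- F) phi j (X j w))%:E =
  \prod_(j <- F) \int[P]_w (phi j (X j w))%:E.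
Proof.
move=> indep FI; have mX j : measurable_fun setT (X j) by [].
(* The factors are freed one at a time, starting from indicator functions. *)
suff H : forall (s : seq J) (psi : J -> T' -> R),
    (forall j, measurable_fun setT (psi j)) -> (forall j u, 0 <= psi j u)%R ->
    (forall j, \int[P]_w (psi j (X j w))%:E \is a fin_num) ->
    (forall j, j \in F -> j \notin s ->
      exists2 B, measurable B & psi j = \1_B) ->
    \int[P]_w (\prod_(j <- F) psi j (X j w))%:E =
    \prod_(j <- F) \int[P]_w (psi j (X j w))%:E.
  move=> mphi phi0 fphi; apply: (H (enum_fset F)) => // j jF /negP.
  by rewrite jF.
have indicX j (B : set T') w : \1_B (X j w) = \1_(X j @^-1` B) w :> R.
  by rewrite !indicE; congr (_%:R); apply/idP/idP; rewrite !inE.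
have mpre j (B : set T') : measurable B -> measurable (X j @^-1` B).
  by move=> mB; rewrite -[X in measurable X]setTI; exact: mX.
have int_indic j (B : set T') : measurable B ->
    \int[P]_w (\1_B (X j w))%:E = P (X j @^-1` B).
  move=> mB; under eq_integral do rewrite indicX.
  by rewrite integral_indic ?setIT//; exact: mpre.
elim=> [|i s IH] psi mpsi psi0 fpsi hs.
  (* With no factor left to free, each one is the indicator of [B j]. The product is then the
     indicator of an intersection, and the definition of independence applies. *)
  pose B j := psi j @^-1` [set 1%R].
  have mB j : measurable (B j).
    by rewrite -[X in measurable X]setTI; exact: mpsi.
  have psiB j : j \in F -> psi j = \1_(B j).
    move=> jF; have [//|D mD psiD] := hs j jF.
    rewrite psiD; congr (\1_ _); apply/seteqP; rewrite /B psiD.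
    split=> u /=; rewrite indicE; first by move=> /mem_set ->.
    by case: (boolP (u \in D)) => [/set_mem//|_ /eqP]; rewrite eq_sym oner_eq0.
  transitivity (P (\bigcap_(j in [set` F]) (X j @^-1` B j))).
    rewrite -[X in _ = P X]setIT -integral_indic//; last first.
      rewrite bigcap_fset; apply: big_ind => //.
      - by move=> ? ? ? ?; exact: measurableI.
      - by move=> j _; exact: mpre.
    apply: eq_integral => w _; rewrite bigcap_fset -prod_indic; congr EFin.
    rewrite !big_seq; apply: eq_bigr => j jF.
    by rewrite psiB// indicX.
  rewrite indep// !big_seq; apply: eq_bigr => j jF.
  by rewrite -int_indic// psiB.
have [iF|iF] := boolP (i \in F); last first.
  apply: IH => // j jF js; apply: hs => //.
  by rewrite inE negb_or js andbT; apply: contraNneq iF => <-.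
under eq_integral do rewrite (bigD1_seq i)//= ?fset_uniq// mulrC.
rewrite (bigD1_seq i)//= ?fset_uniq// muleC.
apply: ge0_integral_indep_comp => //.
- under eq_fun do rewrite big_mkcond/=.
  apply: measurable_prod => j _; case: (j != i) => //.
  exact: (measurableT_comp (mpsi j) (mX j)).
- by move=> w; apply: prodr_ge0.
- by apply: (big_ind (fun x => x \is a fin_num)) => // x y; exact: fin_numM.
(* With the [i]-th factor replaced by an indicator, the induction hypothesis applies to [psi']. It
   gives the identity on indicators required by [ge0_integral_indep_comp], where [c] is the product
   of the other integrals. *)
move=> B mB; pose psi' j := if j == i then \1_B else psi j.
have psi'i : psi' i = \1_B by rewrite /psi' eqxx.
have psi'j j : j != i -> psi' j = psi j by rewrite /psi' => /negbTE ->.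
have : \int[P]_w (\prod_(j <- F) psi' j (X j w))%:E =
    \prod_(j <- F) \int[P]_w (psi' j (X j w))%:E.
  apply: IH => [j|j u|j|j jF js].
  - by rewrite /psi'; case: eqP => // _; exact: measurable_indic.
  - by rewrite /psi'; case: eqP.
  - rewrite /psi'; case: eqP => // _.
    by rewrite int_indic//; apply: fin_num_measure; exact: mpre.
  - have [->|ji] := eqVneq j i; first by exists B.
    by rewrite psi'j//; apply: hs => //; rewrite inE negb_or ji.
under eq_integral do rewrite (bigD1_seq i)//= ?fset_uniq// mulrC psi'i.
rewrite (bigD1_seq i)//= ?fset_uniq// muleC psi'i => E.
transitivity (\int[P]_w (\prod_(j <- F | j != i) psi' j (X j w) * \1_B (X i w))%:E).
  apply: eq_integral => w _; congr ((_ * _)%:E).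
  by apply: eq_bigr => j ji; rewrite psi'j.
by rewrite E; congr (_ * _); apply: eq_bigr => j ji; rewrite psi'j.
Qed.

End independence.

(** From [exp (-y) >= 1 - y] follows [exp y (1 - y) <= 1], while [(1 + y + 2 y^2) (1 - y) = 1 + y^2
    (1 - 2 y)] is at least 1 for [y <= 1/2]. *)
Lemma expR_le_quadratic (R : realType) (y : R) :
  y <= 1 / 2 -> expR y <= 1 + y + 2 * y ^+ 2.
Proof.
move=> y2; have := expR_ge1Dx (- y); rewrite expRN => h.
have e0 := expR_gt0 y.
have e1 : expR y * (1 - y) <= 1 by rewrite mulrC -ler_pdivlMr// div1r.
have h2 : 1 <= (1 + y + 2 * y ^+ 2) * (1 - y) by nra.
rewrite -(ler_pM2r (_ : 0 < 1 - y)); last by lra.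
exact: le_trans h2.
Qed.

(** * Exponential moments of bounded variables, and domination of a sequence by one integrable
    function *)

Section concentration.
Context d d' (T : measurableType d) (T' : measurableType d') (R : realType)
  (P : probability T R).

Let PT : (P : {measure set T -> \bar R}) setT = 1%E.
Proof. exact: probability_setT. Qed.

Lemma integrable_bounded_RV (X : {RV P >-> T'}) (f : T' -> R) (B : R) :
  measurable_fun setT f -> (forall u, `|f u| <= B) ->
  P.-integrable setT (EFin \o (fun w => f (X w))).
Proof.
move=> mf fB; apply: measurable_bounded_integrable => //.
- by rewrite ltey_eq fin_num_measure.
- by apply: (measurableT_comp mf); exact: measurable_funP.
- exists B; split; first exact: num_real.
  by move=> C BC w _ /=; apply: le_trans (fB _) (ltW BC).
Qed.

Lemma normr_mean_le (X : {RV P >-> T'}) (f : T' -> R) (B : R) :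
  measurable_fun setT f -> (forall u, `|f u| <= B) ->
  `|\int[P]_w f (X w)| <= B.
Proof.
move=> mf fB; have If := integrable_bounded_RV X mf fB.
apply: (le_trans (le_normr_Rintegral _ If)) => //.
apply: (@le_trans _ _ (\int[P]_w (cst B w))).
  apply: le_Rintegral => //.
  - exact: integrable_norm If.
  - exact: finite_measure_integrable_cst.
by rewrite Rintegral_cst// PT mulr1.
Qed.

Lemma mgf_centered_le (X : {RV P >-> T'}) (f : T' -> R) (s : R) :
  measurable_fun setT f -> (forall u, `|f u| <= 1) -> 0 <= s <= 1 / 4 ->
  (\int[P]_w (expR (s * (f (X w) - \int[P]_v f (X v))))%:E <=
   (expR (8 * s ^+ 2))%:E)%E.
Proof.
move=> mf f1 /andP[s0 s4]; set m := \int[P]_v f (X v).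
have m1 : `|m| <= 1 by exact: normr_mean_le.
have mfX : measurable_fun setT (fun w => f (X w)).
  by apply: (measurableT_comp mf); exact: measurable_funP.
have If := integrable_bounded_RV X mf f1.
(* Here [|f - m| <= 2], so the quadratic term is at most [2 s^2 * 4]. The bound [q] is affine in
   [f (X w)], and its linear part has mean zero after centring, which leaves
   [1 + 8 s^2 <= exp (8 s^2)]. *)
pose q w := 1 + 8 * s ^+ 2 - s * m + s * f (X w).
have eq w : expR (s * (f (X w) - m)) <= q w.
  have [fa fb] : - 1 <= f (X w) /\ f (X w) <= 1 by apply/andP; rewrite -ler_norml.
  have [ma mb] : - 1 <= m /\ m <= 1 by apply/andP; rewrite -ler_norml.
  have y2 : s * (f (X w) - m) <= 1 / 2 by nra.
  apply: (le_trans (expR_le_quadratic y2)); rewrite /q.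
  have : (f (X w) - m) ^+ 2 <= 4 by nra.
  have := sqr_ge0 s; rewrite exprMn; set a := s ^+ 2; set b := (_ - _) ^+ 2.
  move=> a0 b4; have : a * b <= a * 4 by rewrite ler_wpM2l.
  lra.
apply: (@le_trans _ _ (\int[P]_w (q w)%:E)%E).
  apply: ge0_le_integral => //.
  - apply/measurable_EFinP; apply: measurableT_comp; first exact: measurable_expR.
    by apply: measurable_funM => //; exact: measurable_funB.
  - apply/measurable_EFinP; apply: measurable_funD => //.
    exact: measurable_funM.
  - by move=> w _; rewrite lee_fin.
rewrite /q; under eq_integral do rewrite EFinD EFinM.
rewrite integralD//; last 2 first.
- exact: finite_measure_integrable_cst.
- exact: integrableZl.
rewrite integralZl// integral_cst// PT mule1.
rewrite -[X in (_ + _ * X)%E]fineK; last exact: integrable_fin_num.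
rewrite -/(Rintegral P setT (fun w => f (X w))) -/m -EFinM -EFinD lee_fin.
by rewrite subrK; exact: expR_ge1Dx.
Qed.

Lemma sum_invM_le1 (N : nat) :
  \sum_(0 <= i < N) (i.+1%:R * i.+2%:R)^-1 <= 1 :> R.
Proof.
have -> : \sum_(0 <= i < N) (i.+1%:R * i.+2%:R)^-1 = 1 - N.+1%:R^-1 :> R.
  elim: N => [|N IH]; first by rewrite big_geq// invr1 subrr.
  rewrite big_nat_recr//= IH -!natr1; field.
  by rewrite !natr1 !pnatr_eq0.
by rewrite gerBl invr_ge0.
Qed.

(** [g] is the sum of the [f i] with weights [1 / ((i+1)(i+2))], whose total is at most 1; each
    weighted term is below the sum. Since [g] satisfies the same assumptions as the [f i], the
    construction can be iterated for a double index. *)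
Lemma dominating_series (f : nat -> T -> \bar R) :
  (forall i, measurable_fun setT (f i)) -> (forall i w, 0 <= f i w)%E ->
  (forall i, \int[P]_w f i w <= 1)%E ->
  exists g : T -> \bar R, [/\ measurable_fun setT g, forall w, (0 <= g w)%E,
    (\int[P]_w g w <= 1)%E &
    forall i w, (f i w <= (i.+1%:R * i.+2%:R)%:E * g w)%E].
Proof.
move=> mf f0 f1; pose a i : R := (i.+1%:R * i.+2%:R)^-1.
have a0 i : 0 <= a i by rewrite /a invr_ge0.
have af0 i w : (0 <= (a i)%:E * f i w)%E by rewrite mule_ge0// lee_fin.
have maf i : measurable_fun setT (fun w => (a i)%:E * f i w)%E.
  exact: measurable_funeM.
exists (fun w => \sum_(0 <= i <oo) ((a i)%:E * f i w))%E; split.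
- by apply: (@ge0_emeasurable_sum _ _ _ _ _ xpredT).
- by move=> w; apply: nneseries_ge0.
- rewrite integral_nneseries//; apply: lime_le.
    by apply: is_cvg_nneseries => i _ _; apply: integral_ge0.
  apply: nearW => N; apply: (@le_trans _ _ (\sum_(0 <= i < N) (a i)%:E)%E).
    apply: lee_sum => i _; rewrite ge0_integralZl// ?lee_fin//.
    by rewrite -[leRHS]mule1 lee_wpmul2l// lee_fin.
  by rewrite sumEFin lee_fin sum_invM_le1.
- move=> i w; have b0 : 0 < (i.+1%:R * i.+2%:R : R) by rewrite mulr_gt0.
  rewrite -lee_pdivrMl// -/(a i).
  apply: (le_trans _ (@nneseries_lim_ge _ _ xpredT 0 i.+1 _)) => //.
  rewrite big_nat_recr//= leeDr//.
  by apply: sume_ge0.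
Qed.

End concentration.

(** * Almost sure bounds holding for all indices simultaneously *)

Section uniform_concentration.
Context d d' (T : measurableType d) (T' : measurableType d') (R : realType)
  (P : probability T R).

Lemma integral_prod_indep_seq (J : choiceType) (I : set J)
    (X : J -> {RV P >-> T'}) (s : seq J) (phi : J -> T' -> R) :
  independent_RVs I X -> uniq s -> (forall j, j \in s -> I j) ->
  (forall j, measurable_fun setT (phi j)) -> (forall j u, 0 <= phi j u) ->
  (forall j, \int[P]_w (phi j (X j w))%:E \is a fin_num)%E ->
  (\int[P]_w (\prod_(j <- s) phi j (X j w))%R%:E =
  \prod_(j <- s) \int[P]_w (phi j (X j w))%:E)%E.
Proof.
move=> indep us sI mphi phi0 fphi; pose F := [fset j in s]%fset.
have Fs : perm_eq s F.
  by apply: uniq_perm => // j; rewrite in_fset.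
rewrite (perm_big _ Fs)/= -(integral_prod_indep indep)//.
  by apply: eq_integral => w _; rewrite (perm_big _ Fs).
by move=> j /=; rewrite in_fset => /sI.
Qed.

Lemma integral_expR_indep_sum_le (X : nat -> {RV P >-> T'}) (f : T' -> R) (s : R)
    (k : nat) :
  independent_RVs [set j | (1 <= j)%N] X ->
  measurable_fun setT f -> (forall u, `|f u| <= 1) -> 0 <= s <= 1 / 4 ->
  (\int[P]_w (expR (s * \sum_(1 <= j < k.+1)
     (f (X j w) - \int[P]_v f (X j v)) - 8 * s ^+ 2 * k%:R))%:E <= 1)%E.
Proof.
move=> indep mf f1 s14; set c := 8 * s ^+ 2 * k%:R.
pose phi (j : nat) (u : T') := expR (s * (f u - \int[P]_v f (X j v))).
have mphi j : measurable_fun setT (phi j).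
  apply: measurableT_comp; first exact: measurable_expR.
  by apply: measurable_funM => //; exact: measurable_funB.
have phiX j : measurable_fun setT (fun w => phi j (X j w)).
  by apply: (measurableT_comp (mphi j)); exact: measurable_funP.
have phi_le j : (\int[P]_w (phi j (X j w))%:E <= (expR (8 * s ^+ 2))%:E)%E.
  exact: mgf_centered_le.
have phi_ge0 j : (0 <= \int[P]_w (phi j (X j w))%:E)%E.
  by apply: integral_ge0 => w _; rewrite lee_fin expR_ge0.
under eq_integral => w _.
  rewrite expRD mulrC EFinM.
  rewrite (_ : expR (s * _) = \prod_(1 <= j < k.+1) phi j (X j w)); last first.
    by rewrite mulr_sumr expR_sum.
  over.
rewrite ge0_integralZl//; last 2 first.
- by apply/measurable_EFinP; apply: measurable_prod.
- by move=> w _; rewrite lee_fin prodr_ge0// => j _; exact: expR_ge0.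
rewrite (integral_prod_indep_seq indep)//; last 4 first.
- exact: iota_uniq.
- by move=> j; rewrite mem_index_iota => /andP[].
- by move=> j u; exact: expR_ge0.
- by move=> j; rewrite ge0_fin_numE// (le_lt_trans (phi_le _))// ltry.
have prod_le : (\prod_(1 <= j < k.+1) \int[P]_w (phi j (X j w))%:E <=
    (expR c)%:E)%E.
  apply: (@le_trans _ _ (\prod_(1 <= j < k.+1) (expR (8 * s ^+ 2))%:E)%E).
    suff : forall t : seq nat,
        (0 <= \prod_(j <- t) \int[P]_w (phi j (X j w))%:E <=
         \prod_(j <- t) (expR (8 * s ^+ 2))%:E)%E.
      by move=> /(_ (index_iota 1 k.+1)) /andP[].
    elim=> [|j t /andP[IH0 IH]]; first by rewrite !big_nil lee01 lexx.
    by rewrite !big_cons mule_ge0// lee_pmul.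
  by rewrite prodEFin prodr_const_nat subn1 /c expRM_natr.
apply: (le_trans (lee_wpmul2l _ prod_le)); first by rewrite lee_fin expR_ge0.
by rewrite -EFinM lee_fin -expRD addNr expR0.
Qed.

(** Only the upper bound is claimed: the lower one comes from applying the lemma to the opposite
    functions. The dominating function is built over [m] for each [k], and then over [k]. *)
Lemma uniform_concentration (X : nat -> {RV P >-> T'})
    (f : nat -> nat -> T' -> R) :
  independent_RVs [set j | (1 <= j)%N] X ->
  (forall k m, measurable_fun setT (f k m)) ->
  (forall k m u, `|f k m u| <= 1) ->
  {ae P, forall w, exists C : R, forall k m : nat,
    \sum_(1 <= j < k.+1) (f k m (X j w) - \int[P]_v f k m (X j v)) <=
    C * Num.sqrt (k%:R * (ln k.+2%:R + ln m.+2%:R))}.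
Proof.
move=> indep mf f1.
pose l k m : R := ln k.+2%:R + ln m.+2%:R.
have ln2 i : 1 / 2 <= ln i.+2%:R :> R.
  rewrite -[leLHS]expRK ler_ln ?posrE ?expR_gt0//.
  apply: le_trans (expR_le_quadratic (lexx _)) _.
  by rewrite (@le_trans _ _ 2)// ?ler_nat//; lra.
have l1 k m : 1 <= l k m by rewrite /l; have := ln2 k; have := ln2 m; lra.
(* The Chernoff parameter; for [l k m > k] the trivial bound [2 k] suffices. *)
pose s k m : R := if l k m <= k%:R then Num.sqrt (l k m / k%:R) / 4 else 0.
have s14 k m : 0 <= s k m <= 1 / 4.
  rewrite /s; case: ifPn => [lk|_]; last by lra.
  have k0 : 0 < k%:R :> R by have := l1 k m; lra.
  have -> : (1 / 4 = Num.sqrt 1 / 4 :> R) by rewrite sqrtr1.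
  rewrite divr_ge0 ?sqrtr_ge0//= ler_wpM2r// ler_wsqrtr//.
  by rewrite ler_pdivrMr// mul1r.
pose S k m w := \sum_(1 <= j < k.+1) (f k m (X j w) - \int[P]_v f k m (X j v)).
pose e k m w := expR (s k m * S k m w - 8 * s k m ^+ 2 * k%:R).
have mS k m : measurable_fun setT (S k m).
  apply: measurable_sum => j; apply: measurable_funB => //.
  by apply: (measurableT_comp (mf k m)); exact: measurable_funP.
have me k m : measurable_fun setT (fun w => (e k m w)%:E).
  apply/measurable_EFinP; apply: measurableT_comp; first exact: measurable_expR.
  by apply: measurable_funB => //; exact: measurable_funM.
have e_int k m : (\int[P]_w (e k m w)%:E <= 1)%E.
  exact: integral_expR_indep_sum_le.
have e_ge0 k m w : (0 <= (e k m w)%:E)%E by rewrite lee_fin expR_ge0.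
have /choice[g Hg] : forall k, exists g : T -> \bar R,
    [/\ measurable_fun setT g, forall w, (0 <= g w)%E, (\int[P]_w g w <= 1)%E &
    forall m w, ((e k m w)%:E <= (m.+1%:R * m.+2%:R)%:E * g w)%E].
  by move=> k; exact: (@dominating_series _ _ _ _ (fun m w => (e k m w)%:E)).
have mg k : measurable_fun setT (g k) by case: (Hg k).
have g_ge0 k w : (0 <= g k w)%E by case: (Hg k).
have g_int k : (\int[P]_w g k w <= 1)%E by case: (Hg k).
have [G [mG G0 G1 gG]] := dominating_series mg g_ge0 g_int.
have /integrable_ae : P.-integrable setT G.
  apply/integrableP; split => //.
  under eq_integral do rewrite gee0_abs//.
  exact: le_lt_trans G1 (ltry _).
move=> /(_ measurableT); apply: filterS => w /(_ I) Gfin.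
pose x := fine (G w).
have x0 : 0 <= x by rewrite fine_ge0.
have lnx0 : 0 <= ln (x + 1) by rewrite ln_ge0// lerDr.
(* The weights are relaxed to squares so that the logarithm of the bound is [2 l + ln (x + 1)].
   Using [x + 1] in place of [x] keeps the last logarithm nonnegative. *)
have eb k m : e k m w <= (k.+2%:R ^+ 2 * m.+2%:R ^+ 2) * (x + 1).
  have [_ _ _ /(_ m w) em] := Hg k.
  rewrite -lee_fin; apply: (le_trans em).
  apply: (@le_trans _ _ ((m.+1%:R * m.+2%:R)%:E *
      ((k.+1%:R * k.+2%:R)%:E * x%:E))%E).
    by rewrite lee_wpmul2l// fineK.
  rewrite -!EFinM lee_fin mulrA ler_pM// ?mulr_ge0// ?lerDl//.
  rewrite mulrC !expr2 ler_pM ?mulr_ge0//.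
    by rewrite ler_pM2r// ler_nat.
  by rewrite ler_pM2r// ler_nat.
(* With [s = r / 4] and [l = k r^2], the term [8 s^2 k] equals [l / 2]. Hence
   [(r / 4) S <= (1/2 + 2) l + ln (x + 1)], and the last term is absorbed since [l >= 1]. Dividing
   by [r / 4] gives the constant, as [k r = sqrt (k l)]. *)
exists (4 * (5 / 2 + ln (x + 1))) => k m; rewrite -/(l k m) -/(S k m w).
have [lk|kl] := leP (l k m) k%:R.
  have k0 : 0 < k%:R :> R by have := l1 k m; lra.
  have l0 : 0 < l k m by have := l1 k m; lra.
  pose r := Num.sqrt (l k m / k%:R).
  have r0 : 0 < r by rewrite sqrtr_gt0 divr_gt0.
  have r2 : r ^+ 2 = l k m / k%:R by rewrite sqr_sqrtr// divr_ge0// ltW.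
  have lE : l k m = k%:R * r ^+ 2 by rewrite r2 mulrC divfK// gt_eqF.
  have -> : Num.sqrt (k%:R * l k m) = k%:R * r.
    by rewrite {1}lE mulrA -expr2 -exprMn sqrtr_sqr ger0_norm// mulr_ge0// ltW.
  have sE : s k m = r / 4 by rewrite /s lk.
  have : s k m * S k m w - 8 * s k m ^+ 2 * k%:R <= 2 * l k m + ln (x + 1).
    rewrite -ler_expR -/(e k m w) (le_trans (eb k m))// expRD.
    rewrite [X in _ <= _ * X]lnK ?posrE ?ltr_wpDl// ler_wpM2r// ?addr_ge0//.
    rewrite /l mulrDr expRD ![2 * ln _]mulrC !expRM_natr.
    by rewrite !lnK ?posrE.
  rewrite sE => H.
  have : r * S k m w <= r * (4 * (5 / 2 + ln (x + 1)) * (k%:R * r)).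
    have : ln (x + 1) <= ln (x + 1) * l k m by rewrite ler_peMr.
    move: H; rewrite lE; nra.
  by rewrite ler_pM2l.
have kS : k%:R <= Num.sqrt (k%:R * l k m).
  rewrite -[leLHS]ger0_norm// -sqrtr_sqr ler_wsqrtr// expr2 ler_wpM2l//.
  exact: ltW.
apply: (@le_trans _ _ (2 * k%:R)); last first.
  have : 0 <= k%:R :> R by [].
  nra.
apply: (@le_trans _ _ (\sum_(1 <= j < k.+1) 2)).
  apply: ler_sum => j _.
  have := f1 k m (X j w); have := normr_mean_le (X j) (mf k m) (f1 k m).
  by rewrite !ler_norml; lra.
by rewrite sumr_const_nat subn1 mulr_natr.
Qed.
End uniform_concentration.

(** * Stieltjes integrals of bounded functions over half-open intervals *)

Section stieltjes.
Context (R : realType) (M : cumulative R R).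
Local Notation mu := (lebesgue_stieltjes_measure M).

Lemma lebesgue_stieltjes_itv_oc (a b : R) : a <= b ->
  mu `]a, b] = (M b - M a)%:E.
Proof.
move=> ab; rewrite /lebesgue_stieltjes_measure /measure_extension.
by rewrite measurable_mu_extE/=; [rewrite wlength_itv_bnd | exact: is_ocitv].
Qed.

Lemma integrable_stieltjes_oc (f : R -> R) (B a b : R) :
  measurable_fun setT f -> (forall u, `|f u| <= B) ->
  mu.-integrable `]a, b] (EFin \o f).
Proof.
move=> mf fB; apply: measurable_bounded_integrable => //.
- have [ab|ba] := leP a b.
    by rewrite [ltLHS](lebesgue_stieltjes_itv_oc ab) ltry.
  by rewrite set_itv_ge ?measure0// bnd_simp -leNgt ltW.
- exact: measurable_funTS.
- exists B; split; first exact: num_real.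
  by move=> C BC u _ /=; apply: le_trans (fB _) (ltW BC).
Qed.

Lemma Rintegral_stieltjes_split (f : R -> R) (B a b c : R) :
  measurable_fun setT f -> (forall u, `|f u| <= B) -> a <= b -> b <= c ->
  \int[mu]_(u in `]a, c]) f u =
  \int[mu]_(u in `]a, b]) f u + \int[mu]_(u in `]b, c]) f u.
Proof.
move=> mf fB ab bc.
have abc : `]a, c]%classic = `]a, b] `|` `]b, c] :> set R.
  by apply: itv_bndbnd_setU; rewrite bnd_simp.
rewrite [X in Rintegral _ X _]abc Rintegral_setU//.
  by rewrite -abc; exact: integrable_stieltjes_oc fB.
apply/disj_setPS => u [/=]; rewrite !in_itv/= => /andP[_ ub] /andP[bu _].
by have := le_lt_trans ub bu; rewrite ltxx.
Qed.

Lemma normr_Rintegral_stieltjes_le (f : R -> R) (a b : R) :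
  measurable_fun setT f -> (forall u, `|f u| <= 1) -> a <= b ->
  `|\int[mu]_(u in `]a, b]) f u| <= M b - M a.
Proof.
move=> mf f1 ab; have If := @integrable_stieltjes_oc f 1 a b mf f1.
apply: (le_trans (le_normr_Rintegral _ If)) => //.
apply: (@le_trans _ _ (\int[mu]_(u in `]a, b]) (cst 1 u))).
  apply: le_Rintegral => //.
  - exact: integrable_norm If.
  - by apply: (@integrable_stieltjes_oc _ 1) => // u; rewrite normr1.
rewrite Rintegral_cst// mul1r.
by rewrite [X in fine X](lebesgue_stieltjes_itv_oc ab).
Qed.

End stieltjes.

(** * Order properties of the level points *)

Section levels.
Context (R : realType) (x0 : R) (M : cumulative R R).
Context (M_supp : forall x, x < x0 -> M x = 0) (M_x0 : M x0 = 0)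
  (M_level : forall j : nat, (1 <= j)%N -> M (level_point x0 M j) = j%:R).
Local Notation xi := (level_point x0 M).

Lemma stieltjes_nd : {homo M : x y / x <= y}.
Proof. exact: cumulative_is_nondecreasing. Qed.

Lemma stieltjes_ge0 x : 0 <= M x.
Proof.
have [xx0|x0x] := ltP x x0; first by rewrite M_supp.
by rewrite -M_x0; exact: stieltjes_nd.
Qed.

Lemma M_level_point j : M (xi j) = j%:R.
Proof. by case: j => [|j]; [exact: M_x0 | exact: M_level]. Qed.

Lemma level_point_nd i j : (i <= j)%N -> xi i <= xi j.
Proof.
rewrite leq_eqVlt => /predU1P[->//|ij]; rewrite leNgt; apply/negP => /ltW.
by move=> /stieltjes_nd; rewrite !M_level_point ler_nat leqNgt ij.
Qed.

Lemma level_point_ge_x0 j : x0 <= xi j.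
Proof. exact: (@level_point_nd 0 j). Qed.

Lemma level_point_le j x : x0 <= x -> j%:R <= M x -> xi j <= x.
Proof.
case: j => // j x0x jx; apply: ge_inf => //.
(* [ge_inf] needs the set to be bounded below; [x0] is such a bound because [M] vanishes to its left
   and the level is positive. *)
exists x0 => y /= jy; rewrite leNgt; apply/negP => /M_supp My.
by move: jy; rewrite My lern0.
Qed.

Lemma lt_level_point j x : M x < j%:R -> x < xi j.
Proof.
move=> Mx; rewrite ltNge; apply/negP => /stieltjes_nd.
by rewrite M_level_point leNgt Mx.
Qed.

End levels.

(** * The laws of the sampled points, and the zero set of [M] *)

Section level_law.
Context (R : realType) (x0 : R) (M : cumulative R R) (d : measure_display)
  (T : measurableType d) (P : probability T R) (n : nat -> {RV P >-> R}).
Context (M_supp : forall x, x < x0 -> M x = 0) (M_x0 : M x0 = 0)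
  (M_level : forall j : nat, (1 <= j)%N -> M (level_point x0 M j) = j%:R)
  (n_law : forall j : nat, (1 <= j)%N -> forall A : set R, measurable A ->
     distribution P (n j) A =
     mrestr (lebesgue_stieltjes_measure M)
       (measurable_itv `]level_point x0 M j.-1, level_point x0 M j]) A).
Local Notation xi := (level_point x0 M).
Local Notation mu := (lebesgue_stieltjes_measure M).

Lemma ae_level_itv :
  {ae P, forall w, forall j, (1 <= j)%N -> xi j.-1 < n j w <= xi j}.
Proof.
apply: ae_foralln => j; have [->|j0] := posnP j; first exact: aeW.
have mA : measurable (~` `]xi j.-1, xi j] : set R) by exact: measurableC.
have nA : P (n j @^-1` (~` `]xi j.-1, xi j])) = 0.
  by have := n_law j0 mA; rewrite /mrestr/= setICl measure0.
exists (n j @^-1` (~` `]xi j.-1, xi j])); split => //.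
  by rewrite -[X in measurable X]setTI; apply: measurable_funP.
by move=> w /= nw h; apply: nw => _; move: h; rewrite in_itv.
Qed.

(** Change of variables along [n j]: the image measure does not charge the complement of the level
    interval, and agrees with [mu] on its measurable subsets. *)
Lemma Rintegral_level_law (f : R -> R) (B : R) (j : nat) :
  measurable_fun setT f -> (forall u, `|f u| <= B) -> (1 <= j)%N ->
  \int[P]_w f (n j w) = \int[mu]_(u in `]xi j.-1, xi j]) f u.
Proof.
move=> mf fB j1; pose phi : T -> measurableTypeR R := n j.
have mphi : measurable_fun setT phi.
  by move=> mT A mA; rewrite setTI; exact: (measurable_funPTI (n j)).
have mf' : measurable_fun [set: measurableTypeR R] (EFin \o f).
  exact/measurable_EFinP.
have If : P.-integrable (phi @^-1` setT) ((EFin \o f) \o phi).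
  by rewrite preimage_setT; exact: integrable_bounded_RV fB.
rewrite /Rintegral; congr fine.
have := integral_pushforward mphi mf' If measurableT.
rewrite preimage_setT => <-.
pose D : set (measurableTypeR R) := `]xi j.-1, xi j]%classic.
have mD : measurable D by exact: measurable_itv.
rewrite (@negligible_integral _ _ _ _ _ (~` D))//; last 3 first.
- exact: measurableC.
- exact: integrable_pushforward.
- have mDC : measurable (~` `]xi j.-1, xi j] : set R) by exact: measurableC.
  by have := n_law j1 mDC; rewrite /mrestr/= setICl measure0.
rewrite setDE setCK setTI.
apply: eq_measure_integral => A mA AD.
by have := n_law j1 mA; rewrite /mrestr/= setIidl.
Qed.

(** The level intervals tile [(x0, xi k]], so the sum of the means is the main term of the theorem
    at a level point. *)
Lemma sum_Rintegral_level_law (f : R -> R) (B : R) (k : nat) :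
  measurable_fun setT f -> (forall u, `|f u| <= B) ->
  \sum_(1 <= j < k.+1) \int[P]_w f (n j w) = \int[mu]_(u in `]x0, xi k]) f u.
Proof.
move=> mf fB; elim: k => [|k IH].
  by rewrite big_geq// set_itv_ge ?bnd_simp ?ltxx// Rintegral_set0.
rewrite big_nat_recr//= IH (Rintegral_level_law mf fB)//=.
rewrite -(@Rintegral_stieltjes_split _ M f B)//.
- exact: (@level_point_ge_x0 _ x0 M M_x0 M_level).
- exact: (@level_point_nd _ x0 M M_x0 M_level k k.+1 (leqnSn k)).
Qed.

(** The zero set is a ray, closed or open at its supremum. In the closed case one point suffices; in
    the open case, a jump of [M] at the supremum, it is exhausted from the left. Countability allows
    a union of null events. *)
Lemma stieltjes_zeros_cover : exists b : nat -> R,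
  (forall i, x0 <= b i /\ M (b i) = 0) /\
  (forall u, M u = 0 -> exists i, u <= b i).
Proof.
have Mnd := stieltjes_nd M; have M0 := stieltjes_ge0 M_supp M_x0.
pose S := [set u | M u = 0].
have supS : has_sup S.
  split; first by exists x0.
  exists (xi 1) => u /= Mu; apply: ltW.
  by apply: (@lt_level_point _ x0 M M_x0 M_level 1); rewrite Mu ltr01.
have S_le u : S u -> u <= sup S by move=> Su; apply: ub_le_sup => //; case: supS.
have [Ma|Ma] := eqVneq (M (sup S)) 0.
  by exists (fun=> sup S); split=> [_|u Su]; [split=> //; exact: S_le |
    exists 0%N; exact: S_le].
exists (fun i => Num.max x0 (sup S - i.+1%:R^-1)); split=> [i|u Su].
  split; first by rewrite le_max lexx.
  have i0 : 0 < i.+1%:R^-1 :> R by rewrite invr_gt0.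
  have [v /= Sv lv] := sup_adherent i0 supS.
  apply/eqP; rewrite eq_le M0 andbT; case: (leP x0 (sup S - i.+1%:R^-1)) => _.
    by apply: (le_trans (Mnd _ _ (ltW lv))); rewrite Sv.
  by rewrite M_x0.
have ua : u < sup S.
  by rewrite lt_neqAle S_le// andbT; apply: contraNneq Ma => <-; apply/eqP.
(* This index makes [1 / (i + 1)] at most the distance from [u] to the supremum. *)
exists (Num.truncn (sup S - u)^-1).
rewrite le_max; apply/orP; right.
rewrite lerBrDr -lerBrDl -[leRHS]invrK lef_pV2 ?posrE ?invr_gt0 ?subr_gt0//.
exact/ltW/truncnS_gt.
Qed.

(* The right-hand side of the theorem vanishes with [M x], so no sampled point may
   lie where [M] is zero. *)
Lemma ae_stieltjes_first_gt0 : {ae P, forall w, 0 < M (n 1 w)}.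
Proof.
have [b [bM bS]] := stieltjes_zeros_cover.
(* The interval [(x0, b i]] has mass [M (b i) - M x0 = 0]. Almost surely [n 1] exceeds [x0] and
   avoids all these intervals, hence the zero set. *)
have nb i : {ae P, forall w, ~ (x0 < n 1 w <= b i)}.
  have mA : measurable (`]x0, b i] : set R) by [].
  exists (n 1 @^-1` `]x0, b i]); split.
  - exact: (measurable_funPTI (n 1)).
  - have -> : P (n 1 @^-1` `]x0, b i]) = mu (`]x0, b i] `&` `]xi 0, xi 1]).
      exact: (n_law (leqnn 1) mA).
    apply/eqP; rewrite eq_le measure_ge0 andbT.
    apply: (@le_trans _ _ (mu `]x0, b i])).
      by apply: le_measure; rewrite ?inE//; apply: measurableI.
    have [x0b Mb] := bM i.
    by rewrite lebesgue_stieltjes_itv_oc// Mb M_x0 subrr.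
  - by move=> w /= /contrapT; rewrite in_itv.
move: (ae_foralln nb) ae_level_itv; apply: filterS2 => w nbw nw.
rewrite lt_neqAle (stieltjes_ge0 M_supp M_x0) andbT; apply/eqP => M0.
have [i ni] := bS (n 1 w) (esym M0).
by apply: (nbw i); rewrite ni andbT; have /andP[] := nw 1%N (leqnn 1).
Qed.

End level_law.

(** * Elementary bounds for the square root, cosine and sine *)

Section real_functions.
Context (R : realType).

Lemma sqrtrD_le (a b : R) : 0 <= a -> 0 <= b ->
  Num.sqrt (a + b) <= Num.sqrt a + Num.sqrt b.
Proof.
move=> a0 b0; have sa := sqrtr_ge0 a; have sb := sqrtr_ge0 b.
rewrite -(@ler_pXn2r _ 2) ?nnegrE ?sqrtr_ge0 ?addr_ge0// sqrrD.
by rewrite !sqr_sqrtr ?addr_ge0// -addrA lerD2l lerDr mulrn_wge0// mulr_ge0.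
Qed.

Lemma derive_bounded_lipschitz (f df : R -> R) :
  (forall x : R, is_derive x (1 : R) f (df x)) -> (forall x, `|df x| <= 1) ->
  forall a b, `|f a - f b| <= `|a - b|.
Proof.
move=> fdf df1 a b; wlog ab : a b / a < b => [H|].
  have [->|ab] := eqVneq a b; first by rewrite !subrr.
  have [ab'|ba|E] := ltgtP a b; first exact: H.
    by rewrite distrC [leRHS]distrC; exact: H.
  by rewrite E eqxx in ab.
have cf : {within `[a, b], continuous f}.
  apply: continuous_subspaceT => x.
  by apply: differentiable_continuous; apply/derivable1_diffP; case: (fdf x).
have [c _ fE] := MVT ab (fun x _ => fdf x) cf.
by rewrite distrC fE normrM [leRHS]distrC ler_piMl.
Qed.

Lemma cos_lipschitz (a b : R) : `|cos a - cos b| <= `|a - b|.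
Proof.
apply: (@derive_bounded_lipschitz _ (fun x => - sin x)) => x.
by rewrite normrN sin_max.
Qed.

Lemma sin_lipschitz (a b : R) : `|sin a - sin b| <= `|a - b|.
Proof. by apply: (@derive_bounded_lipschitz _ cos) => x; exact: cos_max. Qed.

End real_functions.

(** * From grid frequencies to all nonnegative frequencies *)

Section grid.
Context (R : realType) (x0 : R) (M : cumulative R R) (alpha2 : R)
  (d : measure_display) (T : measurableType d) (P : probability T R)
  (n : nat -> {RV P >-> R}).
Context (x0_gt0 : 0 < x0) (M_supp : forall x, x < x0 -> M x = 0)
  (M_x0 : M x0 = 0) (alpha2_gt0 : 0 < alpha2)
  (M_growth : exists K : R, forall x, x0 <= x -> M x <= K * x `^ alpha2)
  (M_level : forall j : nat, (1 <= j)%N -> M (level_point x0 M j) = j%:R)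
  (n_law : forall j : nat, (1 <= j)%N -> forall A : set R, measurable A ->
     distribution P (n j) A =
     mrestr (lebesgue_stieltjes_measure M)
       (measurable_itv `]level_point x0 M j.-1, level_point x0 M j]) A)
  (n_indep : independent_RVs [set j : nat | (1 <= j)%N] n).
Local Notation xi := (level_point x0 M).
Local Notation mu := (lebesgue_stieltjes_measure M).

Let xi_ge j : x0 <= xi j.
Proof. exact: (@level_point_ge_x0 _ x0 M M_x0 M_level). Qed.

Let lam_gt0 : 0 < ln (x0 + 1).
Proof. by rewrite ln_gt0// ltrDr. Qed.

Let lam_le (x : R) : x0 <= x -> ln (x0 + 1) <= ln (x + 1).
Proof. by have h0 := x0_gt0; move=> x0x; rewrite ler_ln ?posrE; lra. Qed.

Lemma ln_index_le : exists2 A : R, 0 <= A &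
  forall k, (1 <= k)%N -> ln k.+2%:R <= A * ln (xi k + 1).
Proof.
(* The factor 3 absorbs [k + 2 <= 3 k]. The maximum with 1 makes [ln K'] nonnegative, so that it is
   at most [ln K' / ln (x0 + 1)] times [ln (xi k + 1)]. *)
have [K MK] := M_growth; pose K' := Num.max 1 (3 * K).
have K'1 : 1 <= K' by rewrite le_max lexx.
have K'3 : 3 * K <= K' by rewrite le_max lexx orbT.
exists (ln K' / ln (x0 + 1) + alpha2).
  by apply: addr_ge0; [apply: divr_ge0; [exact: ln_ge0 | exact: ltW] | exact: ltW].
move=> k k1; have xk := xi_ge k; have h0 := x0_gt0; have a0 := alpha2_gt0.
have xk1 : 0 < xi k + 1 by lra.
have : k%:R <= K * xi k `^ alpha2.
  by rewrite -[leLHS](@M_level_point _ x0 M M_x0 M_level); exact: MK.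
have p0 := powR_ge0 (xi k) alpha2.
have p1 : xi k `^ alpha2 <= (xi k + 1) `^ alpha2.
  by apply: ge0_ler_powR; rewrite ?nnegrE; lra.
have k1' : 1 <= k%:R :> R by rewrite ler1n.
move=> kK; have kb : k.+2%:R <= K' * (xi k + 1) `^ alpha2.
  rewrite -addn2 natrD; nra.
have q0 : 0 < (xi k + 1) `^ alpha2 by rewrite powR_gt0.
apply: (@le_trans _ _ (ln K' + alpha2 * ln (xi k + 1))).
  rewrite -ln_powR -lnM ?posrE//; last by lra.
  by rewrite ler_ln ?posrE// mulr_gt0//; lra.
rewrite mulrDl lerD2r -mulrA ler_peMr ?ln_ge0//.
by rewrite mulrC ler_pdivlMr// mul1r lam_le.
Qed.

(** The law of [n j] is carried by a level interval of mass exactly 1. Closeness is required only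
    there, which matters because [ln] is unbounded. *)
Lemma mean_diff_le (f g : R -> R) (e : R) (j : nat) :
  measurable_fun setT f -> measurable_fun setT g ->
  (forall u, `|f u| <= 1) -> (forall u, `|g u| <= 1) -> (1 <= j)%N ->
  (forall u, xi j.-1 < u <= xi j -> `|f u - g u| <= e) ->
  `|\int[P]_w f (n j w) - \int[P]_w g (n j w)| <= e.
Proof.
move=> mf mg f1 g1 j1 fg.
rewrite (Rintegral_level_law n_law mf f1)// (Rintegral_level_law n_law mg g1)//.
have If := @integrable_stieltjes_oc _ M f 1 (xi j.-1) (xi j) mf f1.
have Ig := @integrable_stieltjes_oc _ M g 1 (xi j.-1) (xi j) mg g1.
have Ifg : mu.-integrable `]xi j.-1, xi j] (EFin \o (f \- g)).
  apply: (@integrable_stieltjes_oc _ M _ 2); first exact: measurable_funB.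
  move=> u /=; apply: le_trans (ler_normB _ _) _.
  by have := f1 u; have := g1 u; lra.
rewrite -RintegralB//.
apply: (le_trans (le_normr_Rintegral _ Ifg)) => //.
apply: (@le_trans _ _ (\int[mu]_(u in `]xi j.-1, xi j]) (cst e u))).
  apply: le_Rintegral => //.
  - exact: integrable_norm Ifg.
  - exact: (@integrable_stieltjes_oc _ M _ `|e|).
rewrite Rintegral_cst//.
rewrite [X in _ * fine X](@lebesgue_stieltjes_itv_oc _ M); last first.
  exact: (@level_point_nd _ x0 M M_x0 M_level _ _ (leq_pred j)).
rewrite !(@M_level_point _ x0 M M_x0 M_level)/= -natrB ?leq_pred//.
by rewrite -[j in (j - _)%N](prednK j1) subSnn mulr1.
Qed.

Lemma ae_lipschitz_sum_le (phi : R -> R) :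
  measurable_fun setT phi -> (forall u, `|phi u| <= 1) ->
  (forall a b, `|phi a - phi b| <= `|a - b|) ->
  {ae P, forall w, exists2 C : R, 0 <= C &
    forall (k : nat) (t : R), (1 <= k)%N -> 0 <= t ->
    \sum_(1 <= j < k.+1)
      (phi (t * ln (n j w)) - \int[P]_v phi (t * ln (n j v))) <=
    C * Num.sqrt k%:R * (Num.sqrt (ln (xi k + 1)) + Num.sqrt (ln (t + 1)))
      * ln (xi k + 1)}.
Proof.
move=> mphi phi1 phiL; have h0 := x0_gt0.
have mphit t : measurable_fun setT (fun u => phi (t * ln u)).
  by apply: (measurableT_comp mphi); apply: measurable_funM => //.
pose f (k m : nat) (u : R) := phi (m%:R / k%:R * ln u).
have := @uniform_concentration _ _ _ _ _ _ n f n_indep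
  (fun k m => mphit _) (fun k m u => phi1 _).
have [A A0 lnA] := ln_index_le.
move: (ae_level_itv n_law); apply: filterS2 => w nw [C0 HC0].
pose l0 := ln (x0 + 1); pose C1 := Num.max C0 0.
have C10 : 0 <= C1 by rewrite le_max lexx orbT.
(* The first summand comes from concentration at the grid point, the second from rounding [t]. The
   divisions by [l0] and [sqrt l0] supply missing factors through [L / l0 >= 1] and
   [q / sqrt l0 >= 1], with [q] the sum of the two square roots. *)
exists (C1 * (Num.sqrt (2 * A) + 1) / l0 + 2 * (`|ln x0| / l0 + 1) / Num.sqrt l0).
  have l00 : 0 <= l0 by exact: ltW.
  by rewrite addr_ge0 ?divr_ge0 ?mulr_ge0 ?addr_ge0 ?sqrtr_ge0 ?divr_ge0.
move=> k t k1 t0; set L := ln (xi k + 1).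
have k1' : 1 <= k%:R :> R by rewrite ler1n.
have k0' : 0 < k%:R :> R by rewrite ltr0n.
have lL : l0 <= L by exact: lam_le.
have L0 : 0 < L by exact: lt_le_trans lL.
(* [m / k] is the grid point below [t]; replacing [t] by it costs at most
   [(|ln x0| + L) / k] in each of the [k] terms. *)
pose m := Num.truncn (t * k%:R).
have /andP[m1 m2] : m%:R <= t * k%:R < m.+1%:R by rewrite truncn_itv// mulr_ge0.
have lnb j u : (1 <= j < k.+1)%N -> xi j.-1 < u <= xi j -> `|ln u| <= `|ln x0| + L.
  move=> /andP[j1 jk] /andP[u1 u2].
  have u0 : x0 < u by exact: le_lt_trans (xi_ge _) u1.
  have uk : u <= xi k.
    by apply: le_trans u2 _; exact: (@level_point_nd _ x0 M M_x0 M_level).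
  have lu1 : ln x0 <= ln u by rewrite ler_ln ?posrE; lra.
  have lu2 : ln u <= L by rewrite ler_ln ?posrE; lra.
  have := ler_norm (- ln x0); rewrite normrN ler_norml; have := normr_ge0 (ln x0).
  by lra.
pose e := (`|ln x0| + L) / k%:R.
have phib j u : (1 <= j < k.+1)%N -> xi j.-1 < u <= xi j ->
    `|phi (t * ln u) - f k m u| <= e.
  move=> jk uj; apply: le_trans (phiL _ _) _.
  rewrite -mulrBl normrM /e mulrC ler_pM//; first exact: lnb uj.
  have -> : t - m%:R / k%:R = (t * k%:R - m%:R) / k%:R by field; rewrite gt_eqF.
  rewrite normrM (ger0_norm (_ : 0 <= k%:R^-1)) ?invr_ge0 ?(ltW k0')//.
  rewrite ler_piMl ?invr_ge0 ?(ltW k0')//.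
  by rewrite ger0_norm; [rewrite -natr1 in m2; lra | lra].
(* Rounding changes both the sampled value and its mean by at most [e], so the [k] terms contribute
   at most [2 k e]. *)
have S1 : \sum_(1 <= j < k.+1) (phi (t * ln (n j w)) - \int[P]_v phi (t * ln (n j v))) <=
    \sum_(1 <= j < k.+1) (f k m (n j w) - \int[P]_v f k m (n j v)) + 2 * (`|ln x0| + L).
  have -> : 2 * (`|ln x0| + L) = \sum_(1 <= j < k.+1) (2 * e).
    by rewrite sumr_const_nat subn1 /= -mulr_natr /e; field; rewrite gt_eqF.
  rewrite -big_split/= !big_seq; apply: ler_sum => j.
  rewrite mem_index_iota => jk; have [j1 _] := andP jk.
  have := phib j (n j w) jk (nw j j1).
  have := @mean_diff_le _ _ e j (mphit t) (mphit (m%:R / k%:R))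
    (fun=> phi1 _) (fun=> phi1 _) j1 (fun u => phib j u jk).
  by rewrite !ler_norml -/(f k m); lra.
apply: (le_trans S1).
pose lt' := ln (t + 1); pose q := Num.sqrt L + Num.sqrt lt'.
have lt0 : 0 <= lt' by rewrite ln_ge0//; lra.
(* This is [m + 2 <= (t + 1)(k + 2)], a consequence of [m <= t k]. *)
have lnm : ln m.+2%:R <= lt' + ln k.+2%:R.
  rewrite -lnM ?posrE//; last lra.
  rewrite ler_ln ?posrE// ?mulr_gt0//; last lra.
  rewrite -addn2 natrD -[k.+2]addn2 natrD; nra.
have S2 : \sum_(1 <= j < k.+1) (f k m (n j w) - \int[P]_v f k m (n j v)) <=
    C1 * (Num.sqrt k%:R * ((Num.sqrt (2 * A) + 1) * q)).
  apply: (le_trans (HC0 k m)).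
  apply: (@le_trans _ _ (C1 * Num.sqrt (k%:R * (ln k.+2%:R + ln m.+2%:R)))).
    by rewrite ler_wpM2r ?sqrtr_ge0// le_max lexx.
  rewrite ler_wpM2l// sqrtrM ?(ltW k0')// ler_wpM2l ?sqrtr_ge0//.
  apply: (@le_trans _ _ (Num.sqrt (2 * A * L + lt'))).
    by rewrite ler_wsqrtr//; have := lnA k k1; rewrite -/L; lra.
  apply: le_trans (sqrtrD_le _ _) _ => //; first by rewrite !mulr_ge0// ltW.
  rewrite sqrtrM ?mulr_ge0// /q.
  have := sqrtr_ge0 (2 * A); have := sqrtr_ge0 L; have := sqrtr_ge0 lt'.
  by nra.
have sl0 : 0 < Num.sqrt l0 by rewrite sqrtr_gt0.
have sk1 : 1 <= Num.sqrt k%:R :> R by rewrite -[leLHS]sqrtr1 ler_wsqrtr.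
have ql : Num.sqrt l0 <= q.
  by rewrite /q (le_trans (ler_wsqrtr lL))// lerDl sqrtr_ge0.
rewrite -/L -/lt' -/q.
have q0 : 0 < q by exact: lt_le_trans ql.
have Ll : 1 <= L / l0 by rewrite ler_pdivlMr// mul1r.
have qsl : 1 <= q / Num.sqrt l0 by rewrite ler_pdivlMr// mul1r.
have b0 : 0 <= Num.sqrt (2 * A) + 1 by rewrite addr_ge0 ?sqrtr_ge0.
have T1 : C1 * (Num.sqrt k%:R * ((Num.sqrt (2 * A) + 1) * q)) <=
    C1 * (Num.sqrt (2 * A) + 1) / l0 * Num.sqrt k%:R * q * L.
  have -> : C1 * (Num.sqrt (2 * A) + 1) / l0 * Num.sqrt k%:R * q * L =
    C1 * (Num.sqrt k%:R * ((Num.sqrt (2 * A) + 1) * q)) * (L / l0) by ring.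
  by rewrite ler_peMr// !mulr_ge0 ?sqrtr_ge0// ltW.
have T2 : 2 * (`|ln x0| + L) <=
    2 * (`|ln x0| / l0 + 1) / Num.sqrt l0 * Num.sqrt k%:R * q * L.
  have -> : 2 * (`|ln x0| / l0 + 1) / Num.sqrt l0 * Num.sqrt k%:R * q * L =
    (2 * (`|ln x0| * (L / l0) + L)) * (Num.sqrt k%:R * (q / Num.sqrt l0)) by ring.
  apply: (@le_trans _ _ (2 * (`|ln x0| * (L / l0) + L))).
    by rewrite ler_wpM2l// lerD2r ler_peMr.
  rewrite ler_peMr//; last by rewrite -[leLHS]mulr1 ler_pM.
  by rewrite mulr_ge0// addr_ge0 ?(ltW L0)// mulr_ge0// (le_trans ler01).
move: T1 T2; set a := C1 * _ / l0; set b := 2 * _ / Num.sqrt l0 => T1 T2.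
by rewrite !(mulrDl a b, mulrDl (a * _), mulrDl (a * _ * _)) lerD// (le_trans S2).
Qed.

End grid.

(** * All real frequencies and all cut-off points *)

Section random_sums.
Context (R : realType) (x0 : R) (M : cumulative R R) (alpha2 : R)
  (d : measure_display) (T : measurableType d) (P : probability T R)
  (n : nat -> {RV P >-> R}).
Context (x0_gt0 : 0 < x0) (M_supp : forall x, x < x0 -> M x = 0)
  (M_x0 : M x0 = 0) (alpha2_gt0 : 0 < alpha2)
  (M_growth : exists K : R, forall x, x0 <= x -> M x <= K * x `^ alpha2)
  (M_level : forall j : nat, (1 <= j)%N -> M (level_point x0 M j) = j%:R)
  (n_law : forall j : nat, (1 <= j)%N -> forall A : set R, measurable A ->
     distribution P (n j) A =
     mrestr (lebesgue_stieltjes_measure M)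
       (measurable_itv `]level_point x0 M j.-1, level_point x0 M j]) A)
  (n_indep : independent_RVs [set j : nat | (1 <= j)%N] n).
Local Notation xi := (level_point x0 M).
Local Notation mu := (lebesgue_stieltjes_measure M).

(** The absolute value comes from using both [phi] and its opposite. The parity relation with
    [|s| = 1] reduces negative [t] to positive. *)
Lemma ae_normr_lipschitz_sum_le (phi : R -> R) (s : R) :
  measurable_fun setT phi -> (forall u, `|phi u| <= 1) ->
  (forall a b, `|phi a - phi b| <= `|a - b|) ->
  `|s| = 1 -> (forall u, phi (- u) = s * phi u) ->
  {ae P, forall w, exists2 C : R, 0 <= C & forall (k : nat) (t : R), (1 <= k)%N ->
    `|\sum_(1 <= j < k.+1)
      (phi (t * ln (n j w)) - \int[P]_v phi (t * ln (n j v)))| <=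
    C * Num.sqrt k%:R * (Num.sqrt (ln (xi k + 1)) + Num.sqrt (ln (`|t| + 1)))
      * ln (xi k + 1)}.
Proof.
move=> mphi phi1 phiL s1 phiN.
have mphit t : measurable_fun setT (fun u => phi (t * ln u)).
  by apply: (measurableT_comp mphi); exact: measurable_funM.
have int_scale c t j : \int[P]_v (c * phi (t * ln (n j v))) =
    c * \int[P]_v phi (t * ln (n j v)).
  rewrite RintegralZl//.
  exact: (@integrable_bounded_RV _ _ _ _ _ P (n j) _ 1 (mphit t) (fun=> phi1 _)).
have Nphi1 u : `|- phi u| <= 1 by rewrite normrN.
have NphiL a b : `|- phi a - - phi b| <= `|a - b| by rewrite -opprD normrN.
have main psi := @ae_lipschitz_sum_le _ _ _ _ _ _ P n x0_gt0 M_x0 alpha2_gt0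
  M_growth M_level n_law n_indep psi.
move: (main _ mphi phi1 phiL) (main _ (measurable_funN mphi) Nphi1 NphiL).
apply: filterS2 => w [C1 C10 H1] [C2 C20 H2].
exists (C1 + C2); first exact: addr_ge0.
pose S k t := \sum_(1 <= j < k.+1)
  (phi (t * ln (n j w)) - \int[P]_v phi (t * ln (n j v))).
have h0 := x0_gt0.
have S_pos k t : (1 <= k)%N -> 0 <= t -> `|S k t| <=
    (C1 + C2) * Num.sqrt k%:R * (Num.sqrt (ln (xi k + 1)) + Num.sqrt (ln (t + 1)))
      * ln (xi k + 1).
  move=> k1 t0; have x0k := @level_point_ge_x0 _ x0 M M_x0 M_level k.
  have := H1 k t k1 t0; rewrite -/(S k t) => S1.
  have := H2 k t k1 t0.
  rewrite (_ : \sum_(1 <= j < k.+1) _ = - S k t); last first.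
    rewrite /S -sumrN; apply: eq_bigr => j _; rewrite opprB addrC.
    congr (_ + _); apply: oppr_inj; rewrite opprK -mulN1r -int_scale.
    by apply: eq_Rintegral => v _; rewrite mulN1r.
  move: S1; rewrite -!mulrA !(mulrDl C1 C2).
  set Q := Num.sqrt k%:R * _ => S1 S2.
  have Q0 : 0 <= Q.
    rewrite /Q !mulr_ge0 ?sqrtr_ge0 ?addr_ge0 ?sqrtr_ge0// ln_ge0//; lra.
  rewrite ler_norml; apply/andP; nra.
move=> k t k1; rewrite -/(S k t).
have [t0|t0] := leP 0 t; first by rewrite (ger0_norm t0) S_pos.
rewrite (ltr0_norm t0).
have -> : S k t = s * S k (- t).
  rewrite /S big_distrr/=; apply: eq_bigr => j _; rewrite mulrBr -int_scale.
  congr (_ - _); first by rewrite -phiN mulNr opprK.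
  by apply: eq_Rintegral => v _; rewrite -phiN mulNr opprK.
by rewrite normrM s1 mul1r S_pos// oppr_ge0 ltW.
Qed.

(** For [k] the integer part of [M x], one has [xi k <= x < xi (k+1)]. The points up to index [k]
    lie below [x] and those after [k + 1] lie above; the boolean, read as 0 or 1, decides the point
    of index [k + 1]. *)
Lemma random_index_set (w : T) (x : R) :
  (forall j, (1 <= j)%N -> xi j.-1 < n j w <= xi j) -> x0 <= x ->
  [set j : nat | (1 <= j)%N /\ n j w <= x] =
  [set` index_iota 1 (Num.truncn (M x) + (n (Num.truncn (M x)).+1 w <= x)%R).+1].
Proof.
move=> nw x0x; set k := Num.truncn (M x).
have M0 : 0 <= M x by exact: (stieltjes_ge0 M_supp M_x0).
have /andP[k1 k2] : k%:R <= M x < k.+1%:R by exact: truncn_itv.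
have xik : xi k <= x by exact: (level_point_le M_supp).
have xik1 : x < xi k.+1 by exact: (@lt_level_point _ x0 M M_x0 M_level).
have xi_nd := @level_point_nd _ x0 M M_x0 M_level.
apply/seteqP; split=> j /=; rewrite mem_index_iota ltnS.
  move=> [j1 jx]; rewrite j1 /=.
  have jk : (j <= k.+1)%N.
    rewrite leqNgt; apply/negP => kj.
    have /andP[h _] := nw j j1.
    have h2 : xi k.+1 <= xi j.-1 by apply: xi_nd; rewrite -ltnS prednK.
    by have := lt_trans xik1 (le_lt_trans h2 (lt_le_trans h jx)); rewrite ltxx.
  move: jk; rewrite leq_eqVlt => /predU1P[jE|]; first by rewrite -jE jx addn1 jE.
  by rewrite ltnS => jk; exact: leq_trans jk (leq_addr _ _).
move=> /andP[j1 jk]; split => //.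
have [jk'|kj] := leqP j k.
  have /andP[_ h] := nw j j1.
  by apply: le_trans h (le_trans _ xik); exact: xi_nd.
move: jk; case: (boolP (n k.+1 w <= x)) => [nx|_]; last by rewrite addn0 leqNgt kj.
by rewrite addn1 => jk; have -> : j = k.+1 by apply/eqP; rewrite eqn_leq jk.
Qed.

Lemma random_sum_part_le (psi : R -> R) (w : T) (C a x : R) :
  measurable_fun setT psi -> (forall u, `|psi u| <= 1) ->
  (forall j, (1 <= j)%N -> xi j.-1 < n j w <= xi j) -> 0 < M (n 1 w) ->
  0 <= C -> 0 <= a ->
  (forall k, (1 <= k)%N ->
    `|\sum_(1 <= j < k.+1) (psi (n j w) - \int[P]_v psi (n j v))| <=
    C * Num.sqrt k%:R * (Num.sqrt (ln (xi k + 1)) + a) * ln (xi k + 1)) ->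
  x0 <= x ->
  `|\sum_(1 <= j < (Num.truncn (M x) + (n (Num.truncn (M x)).+1 w <= x)%R).+1)
      psi (n j w) - \int[mu]_(u in `]x0, x]) psi u| <=
  (C + ((Num.sqrt (M (n 1 w)))^-1 + 1) / (Num.sqrt (ln (x0 + 1)) * ln (x0 + 1)))
    * Num.sqrt (M x) * (Num.sqrt (ln (x + 1)) + a) * ln (x + 1).
Proof.
move=> mpsi psi1 nw Mn0 C0 a0 H x0x; have h0 := x0_gt0.
set k := Num.truncn (M x); set b := n k.+1 w <= x.
have M0 : 0 <= M x by exact: (stieltjes_ge0 M_supp M_x0).
have /andP[k1 k2] : k%:R <= M x < k.+1%:R by exact: truncn_itv.
have xik : xi k <= x by exact: (level_point_le M_supp).
have x0k : x0 <= xi k by exact: (@level_point_ge_x0 _ x0 M M_x0 M_level).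
pose l := ln (x0 + 1); pose L := ln (x + 1).
have l0 : 0 < l by rewrite ln_gt0// ltrDr.
have lL : l <= L by rewrite ler_ln ?posrE; lra.
have sl0 : 0 < Num.sqrt l by rewrite sqrtr_gt0.
have slL : Num.sqrt l <= Num.sqrt L by exact: ler_wsqrtr.
pose q := (Num.sqrt L + a) * L.
(* A lower bound on [q] independent of [x] and [a]: it lets the leftover terms of size [sqrt (M x)]
   be absorbed in the final bound. *)
have qq : Num.sqrt l * l <= q by rewrite ler_pM ?(ltW sl0) ?(ltW l0)//; lra.
have q0 : 0 <= q by rewrite (le_trans _ qq)// mulr_ge0// ltW.
have sM0 := sqrtr_ge0 (M x).
have sM2 : Num.sqrt (M x) ^+ 2 = M x by exact: sqr_sqrtr.
have B1 : `|\sum_(1 <= j < k.+1) (psi (n j w) - \int[P]_v psi (n j v))| <=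
    C * Num.sqrt (M x) * q.
  have [->|k0] := posnP k.
    by rewrite big_geq// normr0; apply: mulr_ge0 => //; exact: mulr_ge0.
  apply: (le_trans (H k k0)).
  rewrite /q -!mulrA ler_wpM2l// ler_pM ?sqrtr_ge0//.
  - by rewrite mulr_ge0 ?addr_ge0 ?sqrtr_ge0// ln_ge0//; lra.
  - exact: ler_wsqrtr.
  - have lkL : ln (xi k + 1) <= L by rewrite ler_ln ?posrE; lra.
    have lk0 : 0 <= ln (xi k + 1) by rewrite ln_ge0//; lra.
    by rewrite ler_pM ?addr_ge0 ?sqrtr_ge0// lerD2r ler_wsqrtr.
(* If the extra term is present then [n 1 <= x]: either it is that very point, or
   [n 1 <= xi 1 <= xi k <= x]. So [M (n 1) <= M x], and the quotient of the square roots is at least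
   1. *)
have B2 : b%:R <= (Num.sqrt (M (n 1 w)))^-1 * Num.sqrt (M x).
  case: (boolP b) => [bx|_]; last by rewrite mulr_ge0// invr_ge0 sqrtr_ge0.
  rewrite mulrC ler_pdivlMr ?sqrtr_gt0// mul1r ler_wsqrtr//.
  apply: stieltjes_nd; have [kE|k0] := posnP k; first by move: bx; rewrite /b kE.
  have /andP[_ n1] := nw 1%N (leqnn 1).
  apply: (le_trans n1 (le_trans _ xik)).
  exact: (@level_point_nd _ x0 M M_x0 M_level).
(* For [k = 0] this holds because [M x < 1]; for [k >= 1] the left side is below 1 and the right
   side is at least 1. *)
have B3 : M x - k%:R <= Num.sqrt (M x).
  have [kE|k0] := posnP k.
    by move: k2; rewrite kE subr0 => k2; nra.
  have : 1 <= k%:R :> R by rewrite ler1n.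
  move: k2; rewrite -natr1; nra.
have -> : \sum_(1 <= j < (k + b).+1) psi (n j w) - \int[mu]_(u in `]x0, x]) psi u =
    \sum_(1 <= j < k.+1) (psi (n j w) - \int[P]_v psi (n j v)) +
    (b%:R * psi (n k.+1 w) - \int[mu]_(u in `]xi k, x]) psi u).
  rewrite (@Rintegral_stieltjes_split _ M psi 1 x0 (xi k) x)//.
  rewrite -(@sum_Rintegral_level_law _ x0 M _ _ P n M_x0 M_level n_law psi 1)//.
  rewrite sumrB opprD !addrA; congr (_ - _); rewrite addrAC; congr (_ - _).
  by case: (boolP b) => _; rewrite ?addn0 ?mul0r ?addr0// addn1 big_nat_recr//= mul1r.
have B4 := @normr_Rintegral_stieltjes_le _ M psi (xi k) x mpsi psi1 xik.
rewrite (@M_level_point _ x0 M M_x0 M_level) in B4.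
have B5 : `|b%:R * psi (n k.+1 w)| <= b%:R by rewrite normrM normr_nat ler_piMr.
set c := (Num.sqrt (M (n 1 w)))^-1 + 1.
have c0 : 0 <= c by rewrite addr_ge0// invr_ge0 sqrtr_ge0.
have Z0 : 0 < Num.sqrt l * l by rewrite mulr_gt0.
apply: (@le_trans _ _ (C * Num.sqrt (M x) * q + c * Num.sqrt (M x))).
  apply: le_trans (ler_normD _ _) _; rewrite lerD//.
  by apply: le_trans (ler_normB _ _) _; rewrite /c; lra.
rewrite -/L -/l; set Z := Num.sqrt l * l.
have -> : (C + c / Z) * Num.sqrt (M x) * (Num.sqrt L + a) * L =
    C * Num.sqrt (M x) * q + c * Num.sqrt (M x) * (q / Z) by rewrite /q; ring.
by rewrite lerD2l ler_peMr ?mulr_ge0// ler_pdivlMr// mul1r.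
Qed.

End random_sums.

(** * Real and imaginary parts of the complex powers *)

Section complex_parts.
Context (R : realType).

Lemma cpow_imaginary (u t : R) :
  cpow u (- (t *i)) = cos (t * ln u) +i* (- sin (t * ln u)).
Proof.
rewrite /cpow /cexp.
have -> : - (t *i) * (ln u)%:C = 0 +i* (- (t * ln u)).
  by congr (_ +i* _) => /=; ring.
rewrite /= cosN sinN expR0; congr (_ +i* _) => /=; ring.
Qed.

Lemma sum_Complex (I : Type) (s : seq I) (a b : I -> R) :
  \sum_(i <- s) (a i +i* b i) = (\sum_(i <- s) a i) +i* (\sum_(i <- s) b i).
Proof. by elim: s => [|i s IH]; rewrite ?big_nil// !big_cons IH. Qed.

Lemma normc_le_sum (a b : R) : `|a +i* b| <= (`|a| + `|b|)%:C.
Proof.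
rewrite normc_def lecR/= (le_trans (sqrtrD_le _ _)) ?sqr_ge0//.
by rewrite !sqrtr_sqr.
Qed.

End complex_parts.

Theorem theorem2p2 (R : realType) (x0 : R) (M : cumulative R R) (alpha2 : R)
    (d : measure_display) (T : measurableType d) (P : probability T R)
    (n : nat -> {RV P >-> R})
    (x0_gt0 : 0 < x0)
    (M_unbounded : ~ bounded_fun M)
    (M_supp : forall x, x < x0 -> M x = 0)
    (M_x0 : M x0 = 0)
    (alpha2_gt0 : 0 < alpha2)
    (M_growth : exists K : R, forall x, x0 <= x -> M x <= K * x `^ alpha2)
    (M_level : forall j : nat, (1 <= j)%N -> M (level_point x0 M j) = j%:R)
    (n_law : forall j : nat, (1 <= j)%N -> forall A : set R, measurable A ->
       distribution P (n j) A =
       mrestr (lebesgue_stieltjes_measure M)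
         (measurable_itv `]level_point x0 M j.-1, level_point x0 M j]) A)
    (n_indep : independent_RVs [set j : nat | (1 <= j)%N] n) :
  {ae P, forall w : T, exists C : R, forall x t : R, x0 <= x ->
     `| \sum_(j \in [set j : nat | (1 <= j)%N /\ n j w <= x])
            cpow (n j w) (- (t *i))
        - Cintegral (lebesgue_stieltjes_measure M) `]x0, x]
            (fun u => cpow u (- (t *i))) |
     <= (C * Num.sqrt (M x)
           * (Num.sqrt (ln (x + 1)) + Num.sqrt (ln (`|t| + 1)))
           * ln (x + 1))%:C }.
Proof.
have mcos : measurable_fun setT (@cos R).
  by apply: continuous_measurable_fun; exact: continuous_cos.
have mNsin : measurable_fun setT (fun u : R => - sin u).
  apply: measurable_funN.
  by apply: continuous_measurable_fun; exact: continuous_sin.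
have NsinL (a b : R) : `|- sin a - - sin b| <= `|a - b|.
  by rewrite -opprD normrN sin_lipschitz.
have Nsin1 (u : R) : `|- sin u| <= 1 by rewrite normrN sin_max.
have main phi s := @ae_normr_lipschitz_sum_le _ _ _ _ _ _ P n x0_gt0 M_x0
  alpha2_gt0 M_growth M_level n_law n_indep phi s.
(* The two test functions are [cos] with sign 1 and [- sin] with sign -1, the real and imaginary
   parts of [u^(-it)] as functions of [t ln u]. *)
have c_even (u : R) : cos (- u) = 1 * cos u by rewrite cosN mul1r.
have s_odd (u : R) : - sin (- u) = -1 * - sin u by rewrite sinN mulN1r.
have aeC := main _ _ mcos (@cos_max R) (@cos_lipschitz R) (normr1 _) c_even.
have aeS := main _ _ mNsin Nsin1 NsinL (normrN1 _) s_odd.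
have aeL : {ae P, forall w,
    (forall j, (1 <= j)%N ->
      level_point x0 M j.-1 < n j w <= level_point x0 M j) /\ 0 < M (n 1 w)}.
  move: (ae_level_itv n_law) (ae_stieltjes_first_gt0 M_supp M_x0 M_level n_law).
  by apply: filterS2 => w.
move: aeC aeS aeL; apply: filterS3 => w [C1 C10 H1] [C2 C20 H2] [nw n0].
pose c := ((Num.sqrt (M (n 1 w)))^-1 + 1) / (Num.sqrt (ln (x0 + 1)) * ln (x0 + 1)).
(* The constants for the two parts are added, since [|z| <= |Re z| + |Im z|]. They depend on [w] but
   not on [x] or [t]. *)
exists ((C1 + c) + (C2 + c)) => x t x0x.
have mt (phi : R -> R) : measurable_fun setT phi ->
    measurable_fun setT (fun u => phi (t * ln u)).
  by move=> mphi; apply: (measurableT_comp mphi); exact: measurable_funM.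
have a0 := sqrtr_ge0 (ln (`|t| + 1)).
have B1 := random_sum_part_le x0_gt0 M_supp M_x0 M_level n_law (mt _ mcos)
  (fun=> cos_max _) nw n0 C10 a0 (fun k => H1 k t) x0x.
have B2 := random_sum_part_le x0_gt0 M_supp M_x0 M_level n_law (mt _ mNsin)
  (fun=> Nsin1 _) nw n0 C20 a0 (fun k => H2 k t) x0x.
(* The index set is an initial segment of the positive integers, so the sum over a set becomes an
   ordinary finite sum. *)
rewrite (random_index_set M_supp M_x0 M_level nw x0x) -fsbig_seq ?iota_uniq//.
under eq_bigr do rewrite cpow_imaginary.
have -> : Cintegral (lebesgue_stieltjes_measure M) `]x0, x]
    (fun u => cpow u (- (t *i))) =
    (\int[lebesgue_stieltjes_measure M]_(u in `]x0, x]) cos (t * ln u)) +i*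
    (\int[lebesgue_stieltjes_measure M]_(u in `]x0, x]) (- sin (t * ln u))).
  by rewrite /Cintegral; congr (_ +i* _); apply: eq_Rintegral => u _;
    rewrite cpow_imaginary.
rewrite sum_Complex.
apply: (le_trans (normc_le_sum _ _)).
by rewrite lecR; apply: (le_trans (lerD B1 B2)); rewrite -!mulrDl.
Qed.
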